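(* Suppose $X$ is a metric space and $(X,\mathcal{W})$ is also a wallspace with no vacuous walls, and suppose that each finite radius ball in $X$ is crossed by only finitely many walls. Then $(X,\mathcal{W})$ has compact–wall separation if and only if the dual cube complex $C(X,\mathcal{W})$ is locally finite.
   Context: A wall on a nonempty set $X$ is a pair $\{U,V\}$ of subsets (closed halfspaces) with $U\cup V=X$ (overlap allowed); its open halfspaces are $U\setminus V$ and $V\setminus U$. It is vacuous if it is $\{X,\emptyset\}$. It separates $x,y$ if they lie in distinct open halfspaces; $x$ betwixts it if $x\in U\cap V$. A wallspace $(X,\mathcal{W})$ is a set with an (indexed) collection of walls such that any two points are separated by finitely many walls and each point betwixts finitely many walls. Distinct walls may have the same pair of halfspaces, except that two distinct walls may not be the same genuine partition $\{U,V\}$ with $U\cap V=\emptyset$ and $U,V\neq\emptyset$. A wall crosses a subset $S\subseteq X$ if $S$ meets both of its closed halfspaces. For a nonempty set $K$ and a wall $W=\{U,V\}$, $\mathsf{d}(K,W)$ denotes $\max\{\mathsf{d}(K,U),\mathsf{d}(K,V)\}$; thus $\mathsf{d}(K,W)\ge f$ means that $W$ does not cross the open $f$-neighborhood of $K$. Compact–wall separation: for each nonempty compact $K\subseteq X$ there is a constant $f(K)$ such that whenever $\mathsf{d}(K,W)\ge f(K)$ there is a wall $W'$ separating $K$ from $W$, meaning that $K$ lies in one open halfspace of $W'$ and a closed halfspace of $W$ lies in the other open halfspace of $W'$. Dual cube complex. An orientation $c(W)=(\overleftarrow{c}(W),\overrightarrow{c}(W))$ of a wall $W$ is an ordering of its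 two (indexed) halfspaces. A $0$-cube of $C(X,\mathcal{W})$ is a choice of orientation $c(W)$ for every wall such that (i) $\overleftarrow{c}(W)\cap\overleftarrow{c}(W')\neq\emptyset$ for all walls $W,W'$; (ii) for each $x\in X$, $x\in\overleftarrow{c}(W)$ for all but finitely many $W$. Two $0$-cubes are joined by a $1$-cube iff they differ on exactly one wall; for $n\ge2$ an $n$-cube is added whenever its $(n-1)$-skeleton is present.
   Formalization: In compact–wall separation the wall W' separating K from W is required to be distinct from W; otherwise a genuine partition separates K from itself and the claim fails (infinite star with n-th leaf at distance n, walls {leaf} | rest). *)

(* Defs.v *)
From HB Require Import structures.
From mathcomp Require Import all_boot all_order all_algebra.
From mathcomp Require Import all_classical all_reals all_analysis.
Set Implicit Arguments.
Unset Strict Implicit.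
Unset Printing Implicit Defensive.
Import Order.TTheory GRing.Theory Num.Theory.
Local Open Scope classical_set_scope.
Local Open Scope ring_scope.

Section Walls.
Variables (X I : Type) (H : I -> bool -> set X).

(* [H i true] and [H i false] are the two indexed closed halfspaces of the
   wall [i]; as an unordered pair, {U, V} is [range (H i)]. *)

Definition open_halfspace (i : I) (b : bool) : set X := H i b `\` H i (~~ b).

Definition vacuous (i : I) : Prop := range (H i) = [set setT; set0].

Definition separates (i : I) (x y : X) : Prop :=
  exists b, open_halfspace i b x /\ open_halfspace i (~~ b) y.

Definition betwixts (x : X) (i : I) : Prop := H i true x /\ H i false x.

Definition genuine_partition (i : I) : Prop :=
  H i true `&` H i false = set0 /\ forall b, H i b !=set0.

Definition crosses (i : I) (S : set X) : Prop :=
  forall b, S `&` H i b !=set0.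

Definition separates_from (j : I) (K : set X) (i : I) : Prop :=
  exists b b', K `<=` open_halfspace j b /\
               H i b' `<=` open_halfspace j (~~ b).

End Walls.

Record wallspace (X : Type) := Wallspace {
  wall :> Type;
  halfspace : wall -> bool -> set X;
  wallspace_inhabited : [set: X] !=set0;
  wall_cover : forall W : wall,
    halfspace W true `|` halfspace W false = setT;
  wall_separates_finite : forall x y : X,
    finite_set [set W | separates halfspace W x y];
  wall_betwixts_finite : forall x : X,
    finite_set [set W | betwixts halfspace x W];
  wall_genuine_inj : forall W W' : wall, genuine_partition halfspace W ->
    range (halfspace W) = range (halfspace W') -> W = W'
}.

Section CompactWallSeparation.
Variables (R : realType) (X : metricType R) (W : wallspace X).

(* Extended-real infimum, so that the distance to an empty set is +oo. *)
Definition set_dist (A B : set X) : \bar R :=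
  ereal_inf [set (mdist x y)%:E | x in A & y in B].

Definition wall_dist (K : set X) (w : W) : \bar R :=
  maxe (set_dist K (halfspace w true)) (set_dist K (halfspace w false)).

(* The separating wall [w'] is a wall other than [w]. A genuine partition
   whose open halfspace contains K would otherwise separate K from itself; then
   the leaf walls {leaf} | rest of an infinite star whose n-th leaf is at
   distance n from the center would have compact-wall separation, although
   their dual complex is not locally finite. *)
Definition compact_wall_separation : Prop :=
  forall K : set X, K !=set0 -> compact K ->
  exists f : R, forall w : W, (f%:E <= wall_dist K w)%E ->
  exists w' : W, w' <> w /\ separates_from (@halfspace X W) w' K w.

End CompactWallSeparation.

Section DualCubeComplex.
Variables (X : Type) (W : wallspace X).

(* The orientation c orders the halfspaces of w as
   (halfspace w (c w), halfspace w (~~ c w)). *)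
Definition orientation : Type := W -> bool.

Definition zero_cube (c : orientation) : Prop :=
  (forall w w' : W, halfspace w (c w) `&` halfspace w' (c w') !=set0) /\
  (forall x : X, finite_set [set w : W | ~ halfspace w (c w) x]).

Definition adjacent (c d : orientation) : Prop := exists! w : W, c w <> d w.

(* The vertices of the standard n-cube are {ffun 'I_n -> bool}; [facet i b]
   embeds the standard m-cube as the facet of the standard (m+1)-cube on which
   the i-th coordinate is b. *)
Definition facet (m : nat) (i : 'I_m.+1) (b : bool)
    (v : {ffun 'I_m -> bool}) : {ffun 'I_m.+1 -> bool} :=
  [ffun k => if unlift i k is Some k' then v k' else b].

(* [f] parametrizes the vertices of an n-cube of C(X, W). For n >= 2 the cube
   is present iff its boundary is: f embeds the vertices and every facet is an
   (n-1)-cube. *)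
Fixpoint is_cube (n : nat) : ({ffun 'I_n -> bool} -> orientation) -> Prop :=
  match n with
  | 0 => fun f => forall v, zero_cube (f v)
  | m.+1 => fun f =>
      (forall (i : 'I_m.+1) (b : bool), is_cube (f \o @facet m i b)) /\
      (if m is 0 then forall v v', v <> v' -> adjacent (f v) (f v')
       else injective f)
  end.

(* A cube is recorded as its set of 0-cubes, which determines it, since its
   1-skeleton contains every edge between two of these 0-cubes. *)
Definition cube (S : set orientation) : Prop :=
  exists (n : nat) (f : {ffun 'I_n -> bool} -> orientation),
    is_cube f /\ S = range f.

Definition locally_finite_dual : Prop :=
  forall c : orientation, zero_cube c -> finite_set [set S | cube S /\ S c].

End DualCubeComplex.

(* Main.v *)
Require Import Defs.
From HB Require Import structures.
From mathcomp Require Import all_boot all_order all_algebra.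
From mathcomp Require Import all_classical all_reals all_analysis.
Import Order.TTheory GRing.Theory Num.Theory.
Local Open Scope classical_set_scope.
Local Open Scope ring_scope.

(* C(X, W) is locally finite iff at each 0-cube c only finitely many walls can
   be flipped, since a cube at c only involves walls flippable at c.
   Given compact-wall separation, let K consist of a point x and a point of c(v)
   for each of the finitely many walls v with x outside c(v). If a wall w far
   from K can be flipped at c, the wall v separating K from w must have K on the
   side opposite to c(v), which the choice of K excludes. Conversely, if
   infinitely many walls are not separated from K, a 0-cube orienting the walls
   towards K, apart from the finitely many that cross K, has infinitely many
   flips; so only finitely many walls are not separated from K. *)

(** * Flipping a boolean function at one point *)

Definition flip {T : Type} (c : T -> bool) (t : T) : T -> bool :=
  fun u => if `[< u = t >] then ~~ c u else c u.

Lemma flip_at {T : Type} (c : T -> bool) t : flip c t t = ~~ c t.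
Proof. by rewrite /flip asboolT. Qed.

Lemma flip_off {T : Type} (c : T -> bool) t u : u <> t -> flip c t u = c u.
Proof. by move=> ut; rewrite /flip asboolF. Qed.

Lemma flip_neq {T : Type} (c : T -> bool) t u : flip c t u <> c u <-> u = t.
Proof.
split=> [h|->]; last by rewrite flip_at; case: (c t).
by apply/not_notP => /(flip_off c)/h.
Qed.

Lemma flipK {T : Type} (c : T -> bool) t : flip (flip c t) t = c.
Proof.
apply/funext => u; case: (pselect (u = t)) => [->|ut].
  by rewrite !flip_at negbK.
by rewrite !flip_off.
Qed.

Lemma flip_inj {T : Type} (c : T -> bool) : injective (flip c).
Proof.
move=> t u e; apply/(@flip_neq _ c u t); rewrite -e.
exact: (flip_neq c t t).2.
Qed.

(** Induction on an enumeration of [D]: each new point [x] at most doubles the set, since flipping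
    at [x] repairs a disagreement with [c] there. *)
Lemma finite_bool_fun {T : Type} (D : set T) (c : T -> bool) : finite_set D ->
  finite_set [set d : T -> bool | forall t, ~ D t -> d t = c t].
Proof.
move=> /(@finite_seqP {classic T}) [s ->].
elim: s => [|x s IH] /=.
  apply: sub_finite_set (finite_set1 c) => d /= h.
  by apply/funext => t; apply: h.
pose A := [set d : T -> bool |
  forall t, ~ ((t : {classic T}) \in s) -> d t = c t].
apply: (@sub_finite_set _ _ (A `|` (fun d => flip d x) @` A)).
  move=> d /= h; have [e|e] := eqVneq (d x) (c x); [left|right] => /=.
    move=> t ts; have [->//|tx] := pselect (t = x).
    by apply: h; rewrite inE => /orP[/eqP|].
  exists (flip d x); last exact: flipK.
  move=> t ts; have [->|tx] := pselect (t = x).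
    by rewrite flip_at; case: (d x) (c x) e => [] [].
  by rewrite flip_off //; apply: h; rewrite inE => /orP[/eqP|].
by rewrite finite_setU; split=> //; apply: finite_image.
Qed.

Lemma finite_subsets {T : Type} (A : set T) :
  finite_set A -> finite_set [set B : set T | B `<=` A].
Proof.
move=> fA; have := finite_bool_fun A (fun=> false) fA.
move=> /(finite_image (fun (d : T -> bool) => [set t | d t])).
apply: sub_finite_set => B /= BA; exists (fun t => `[< B t >]) => [t At|].
  by apply/asboolF => /BA.
by apply/seteqP; split=> t /= => [/asboolP|Bt]; last exact/asboolP.
Qed.

(** * Cubes at a 0-cube and its flippable walls *)

Section Cubes.
Context {X : Type} {W : wallspace X}.
Implicit Types c d : orientation W.

Lemma adjacentP c d : Defs.adjacent c d <-> exists w, d = flip c w.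
Proof.
split=> [[w [cd uw]]|[w ->]]; exists w.
  apply/funext => u; have [->|uw'] := pselect (u = w).
    by rewrite flip_at; move: cd; case: (c w) (d w) => [] [].
  by rewrite flip_off //; apply/not_notP => /nesym /uw/nesym.
split; first by apply/nesym/(flip_neq c).
by move=> u /nesym/(flip_neq c).
Qed.

Definition flip_coord {n} (v : {ffun 'I_n -> bool}) (i : 'I_n) :
  {ffun 'I_n -> bool} := [ffun k => if k == i then ~~ v k else v k].

Definition coface {m} (i : 'I_m.+1) (v : {ffun 'I_m.+1 -> bool}) :
  {ffun 'I_m -> bool} := [ffun k => v (lift i k)].

Lemma facetK {m} (i : 'I_m.+1) (v : {ffun 'I_m.+1 -> bool}) :
  facet i (v i) (coface i v) = v.
Proof.
apply/ffunP => k; rewrite ffunE; case: unliftP => [k' ->|->//].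
by rewrite ffunE.
Qed.

Lemma is_cube_zero n (f : {ffun 'I_n -> bool} -> orientation W) v :
  is_cube f -> zero_cube (f v).
Proof.
elim: n f v => [|m IH] f v //= [fc _].
by have := IH _ (coface ord0 v) (fc ord0 (v ord0)); rewrite /= facetK.
Qed.

Lemma is_cube_inj n (f : {ffun 'I_n -> bool} -> orientation W) :
  is_cube f -> injective f.
Proof.
case: n f => [|[|m]] f /=; last by case.
  by move=> _ v v' _; apply/ffunP => - [].
move=> [_ h] v v' e; apply/not_notP => /h.
by rewrite e => -[w []].
Qed.

Lemma is_cube_edge n (f : {ffun 'I_n -> bool} -> orientation W) v i :
  is_cube f -> Defs.adjacent (f v) (f (flip_coord v i)).
Proof.
elim: n f v i => [|m IH] f v i; first by case: i.
case: m IH f v i => [|m] IH f v i /= [fc h].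
  by apply: h => /ffunP/(_ i); rewrite ffunE eqxx; case: (v i).
(* In dimension at least 2, the edge in direction [i] lies in a facet with some other coordinate [j]
   held fixed; there [i] becomes [i']. *)
have [j ji] : exists j, j != i by exists (lift i ord0); rewrite eq_sym neq_lift.
have [i' ei _] := unlift_some ji.
have := IH _ (coface j v) i' (fc j (v j)); rewrite /= facetK.
suff -> : flip_coord v i = facet j (v j) (flip_coord (coface j v) i') by [].
apply/ffunP => k; rewrite !ffunE ei; case: unliftP => [k' ->|->].
  by rewrite !ffunE (inj_eq lift_inj).
by rewrite (negPf (neq_lift _ _)).
Qed.

(* Induction on the Hamming distance from [v0] to [v]: at distance at least 2,
   [f v] has two distinct neighbours that agree with [f v0] at [w], and it can
   differ at [w] from at most one of its neighbours. *)
Lemma is_cube_support n (f : {ffun 'I_n -> bool} -> orientation W) v0 v w :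
  is_cube f -> ~ zero_cube (flip (f v0) w) -> f v w = f v0 w.
Proof.
move=> fc nw; have [d] := ubnP #|[set k | v k != v0 k]|%SET.
elim: d v => // d IH v vd.
have closer i : v i != v0 i -> f (flip_coord v i) w = f v0 w.
  move=> vi; apply: IH; apply: leq_trans (vd : (_ <= d)%N); apply: proper_card.
  apply/properP; split.
    apply/fintype.subsetP => k; rewrite !inE ffunE; case: (eqVneq k i) => [->|//].
    by rewrite vi.
  by exists i; rewrite !inE // ffunE eqxx; case: (v i) (v0 i) vi => [] [].
have [->//|/eqP/ffunP/existsNP[i /eqP vi]] := eqVneq v v0.
have [/existsP[j /andP[ji vj]]|/existsPn h] :=
    boolP [exists j, (j != i) && (v j != v0 j)].
  apply/not_notP => fw.
  have [a ea] := (adjacentP _ _).1 (is_cube_edge _ _ v i fc).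
  have [b eb] := (adjacentP _ _).1 (is_cube_edge _ _ v j fc).
  have wa : w = a by apply/(@flip_neq _ (f v)); rewrite -ea closer //; exact/nesym.
  have wb : w = b by apply/(@flip_neq _ (f v)); rewrite -eb closer //; exact/nesym.
  have /ffunP/(_ i) : flip_coord v i = flip_coord v j.
    by apply: (is_cube_inj _ _ fc); rewrite ea eb -wa -wb.
  by rewrite !ffunE eqxx [i == j]eq_sym (negPf ji); case: (v i).
(* At distance 1, the edge from [v0] flips a single wall [a]; its other end is a 0-cube, so [a] is
   not [w]. *)
have -> : v = flip_coord v0 i.
  apply/ffunP => k; rewrite ffunE; case: eqVneq => [->|ki].
    by case: (v i) (v0 i) vi => [] [].
  by have := h k; rewrite ki /= negbK => /eqP.
have [a ea] := (adjacentP _ _).1 (is_cube_edge _ _ v0 i fc).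
have := is_cube_zero _ _ (flip_coord v0 i) fc; rewrite ea => za.
by apply: flip_off => wa; apply: nw; rewrite wa.
Qed.

(** A cube at [c] is a subset of the orientations that agree with [c] off the flippable walls, and a
    finite set has finitely many subsets. Conversely, distinct flippable walls give distinct edges
    at [c]. *)
Lemma locally_finite_dualE :
  locally_finite_dual W <-> forall c : orientation W, zero_cube c ->
    finite_set [set w | zero_cube (flip c w)].
Proof.
split=> lf c c0; last first.
  have := finite_subsets _ (finite_bool_fun _ c (lf c c0)).
  apply: sub_finite_set => S /= [[n [f [fc ->]]] [v0 _ <-]] _ [v _ <-] w nw.
  exact: is_cube_support.
apply: (@sub_finite_set _ _
  ((fun w => [set c; flip c w]) @^-1` [set S | cube S /\ S c])).
  move=> w /= wc; split; last by left.
  exists 1%N, (fun v => if v ord0 then flip c w else c); split.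
    split=> [i b v /=|v v' vv']; first by case: ifP.
    have : v ord0 != v' ord0.
      by apply/eqP => e; apply: vv'; apply/ffunP => k; rewrite ord1.
    case: (v ord0) (v' ord0) => [] [] // _; apply/adjacentP; exists w => //.
    by rewrite flipK.
  apply/seteqP; split=> [d /= [->|->]|_ /= [v _ <-]].
  - by exists [ffun=> false] => //; rewrite ffunE.
  - by exists [ffun=> true] => //; rewrite ffunE.
  - by case: ifP; [right|left].
apply: finite_preimage (lf c c0) => u w _ _ /seteqP[uw _].
apply: (@flip_inj _ c).
have [|//] := uw (flip c u) (or_intror erefl) => e.
by have := flip_at c u; rewrite {1}e; case: (c u).
Qed.

End Cubes.

(** Only pairs involving [w] have to be rechecked, the pair of [w] with itself being settled by
    nonemptiness; the finiteness condition changes at one wall only. *)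
Lemma zero_cube_flip {X : Type} {W : wallspace X} (c : orientation W) (w : W) :
    zero_cube c -> halfspace w (~~ c w) !=set0 ->
  zero_cube (flip c w) <-> forall v, v <> w ->
    halfspace w (~~ c w) `&` halfspace v (c v) !=set0.
Proof.
move=> [c0 cfin] [p wp]; split=> [[fc _] v vw|h].
  by have := fc w v; rewrite flip_at flip_off.
split=> [u v|x].
  have [->|uw] := pselect (u = w); have [->|vw] := pselect (v = w).
  - by rewrite flip_at; exists p.
  - by rewrite flip_at flip_off //; exact: h.
  - by rewrite flip_at flip_off // setIC; exact: h.
  - by rewrite !flip_off.
apply: (@sub_finite_set _ _ ([set v | ~ halfspace v (c v) x] `|` [set w])).
  move=> v /= hv; have [->|vw] := pselect (v = w); first by right.
  by left; move: hv; rewrite flip_off.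
by rewrite finite_setU; split=> //; exact: cfin.
Qed.

Lemma halfspace_neq0 {X : Type} {W : wallspace X} (w : W) b :
  ~ vacuous (@halfspace X W) w -> halfspace w b !=set0.
Proof.
move=> nv; apply/set0P/eqP => w0; apply: nv.
have wT : halfspace w (~~ b) = setT.
  by have := wall_cover w; case: b w0 => ->; rewrite ?set0U ?setU0.
apply/seteqP; split=> [_ [b' _ <-]|_ [->|->]] /=.
- have [->|] := eqVneq b' b; first by right.
  by case: b b' w0 wT => [] [] // _ ? _; left.
- by exists (~~ b).
- by exists b.
Qed.

(** * Compact sets and the walls near them *)

Section Metric.
Context {R : realType} {X : metricType R} {W : wallspace X}.

Lemma compact_sub_ball (K : set X) (x : X) : compact K ->
  exists r : R, K `<=` ball x r.
Proof.
(* Near-covering compactness along radii tending to infinity: every radius above [mdist x y + 1]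
   gives a ball around [x] containing the unit ball around [y]. *)
move=> /compact_near_coveringP /(_ _ (pinfty_nbhs R) (fun r y => ball x r y)).
case=> [y _|M [_ h]]; last first.
  by exists (M + 1); apply: h; rewrite ltrDl.
exists (ball y 1, [set r | mdist x y + 1 < r]) => /=.
  split; first exact: nbhsx_ballx.
  by exists (mdist x y + 1); split; [exact: num_real|].
move=> [z r] [/= yz xr]; rewrite ballEmdist /=; apply: le_lt_trans xr.
apply: le_trans (metric_triangle x y z) _; rewrite lerD2l.
by move: yz; rewrite ballEmdist => /ltW.
Qed.

Lemma set_dist_le (A B : set X) x y : A x -> B y ->
  (set_dist A B <= (mdist x y)%:E)%E.
Proof. by move=> Ax By; apply: ereal_inf_lbound; exists x => //; exists y. Qed.

Lemma set_dist_lt (A B : set X) (f : R) : (set_dist A B < f%:E)%E ->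
  exists x y, [/\ A x, B y & mdist x y < f].
Proof.
move=> /ereal_inf_lt [_ [x Ax [y By <-]]].
by rewrite lte_fin => xy; exists x, y.
Qed.

Context (halfspaces_neq0 : forall (w : W) b, halfspace w b !=set0)
  (ball_crossed_finite : forall (x : X) (r : R),
    finite_set [set w : W | crosses (@halfspace X W) w (ball x r)]).

(** If [K] lies in the ball of radius [M], a wall with both halfspaces closer than [f] to [K]
    crosses the concentric ball of radius [M + f]. *)
Lemma finite_wall_dist_lt (K : set X) (f : R) : compact K ->
  finite_set [set w : W | (wall_dist K w < f%:E)%E].
Proof.
move=> Kc; have [x _] := wallspace_inhabited W.
have [M KM] := compact_sub_ball _ x Kc.
apply: sub_finite_set (ball_crossed_finite x (M + f)) => w.
rewrite /= /wall_dist gt_max => /andP[wt wf] b.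
have /set_dist_lt[k [y [Kk wy ky]]] : (set_dist K (halfspace w b) < f%:E)%E.
  by case: b.
exists y; split=> //; apply: ball_triangle (KM k Kk) _.
by rewrite ballEmdist.
Qed.

(** * Compact-wall separation against finiteness of flips *)

Lemma finite_flips_of_separation : compact_wall_separation W ->
  forall c : orientation W, zero_cube c ->
  finite_set [set w | zero_cube (flip c w)].
Proof.
move=> cws c c0; have [x _] := wallspace_inhabited W.
pose p w := projT1 (cid (halfspaces_neq0 w (c w))).
have pP w : halfspace w (c w) (p w) := projT2 (cid (halfspaces_neq0 w (c w))).
pose K := x |` (p @` [set w : W | ~ halfspace w (c w) x]).
have Kc : compact K.
  apply: finite_compact; rewrite finite_setU; split=> //.
  by apply: finite_image; exact: c0.2.
have Kx : K x by left.
have [f hf] := cws K (ex_intro _ x Kx) Kc.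
apply: sub_finite_set (finite_wall_dist_lt _ f Kc) => w /= wc.
rewrite ltNge; apply/negP => /hf[v [vw [b [b' [Kv wv]]]]].
(* Otherwise [c v] is the side of [K], and both halfspaces of [w] meet it: one because [c] is a
   0-cube, the other because [w] is flippable and [v] is not [w]. But [halfspace w b'] avoids it. *)
have cvb : c v = ~~ b.
  apply/not_notP => cvb.
  have cv : c v = b by case: (c v) b cvb {Kv wv} => [] [].
  have [y []] : halfspace w b' `&` halfspace v b !=set0.
    rewrite -cv; have [->|] := eqVneq b' (c w); first exact: c0.1.
    move=> bw; have -> : b' = ~~ c w by case: b' (c w) bw {wv} => [] [].
    by apply: (zero_cube_flip _ _ c0 _).1.
  by move=> /wv[_]; rewrite negbK.
(* So [x] lies outside [halfspace v (c v)], hence [p v] was put into [K], although it is not on the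
   side [b]. *)
have [_ nvx] := Kv x Kx.
have [] : open_halfspace (@halfspace X W) v b (p v).
  by apply: Kv; right; exists v => //=; rewrite cvb.
by move=> _; apply; rewrite -cvb; exact: pP.
Qed.

(* A wall [w] violating separation from [K] has a halfspace that meets the
   K-side of every other wall not crossing K; orienting those walls towards K and
   the finitely many walls crossing K towards a point [p w] of that halfspace
   gives a 0-cube at which [w] can be flipped. *)
Lemma finite_unseparated (K : set X) : K !=set0 -> compact K ->
    (forall c : orientation W, zero_cube c ->
      finite_set [set w | zero_cube (flip c w)]) ->
  finite_set [set w : W | ~ exists w' : W,
    w' <> w /\ separates_from (@halfspace X W) w' K w].
Proof.
move=> [x Kx] Kc lf; set bad := [set w : W | _].
pose F := [set w : W | crosses (@halfspace X W) w K].
have Ffin : finite_set F.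
  have [r Kr] := compact_sub_ball _ x Kc.
  apply: sub_finite_set (ball_crossed_finite x r) => w wK b.
  by have [y [Ky wy]] := wK b; exists y; split => //; exact: Kr.
have cover (w : W) y b : ~ halfspace w b y -> halfspace w (~~ b) y.
  have : setT y by []; rewrite -(wall_cover w).
  by case: b => -[].
pose u (w : W) : bool := `[< K `<=` open_halfspace (@halfspace X W) w true >].
have uK w : ~ F w -> K `<=` open_halfspace (@halfspace X W) w (u w).
  move=> /existsNP[b nKb].
  have Kb : K `<=` open_halfspace (@halfspace X W) w (~~ b).
    move=> y Ky; have nby : ~ halfspace w b y by move=> wy; apply: nKb; exists y.
    by split; [exact: cover|rewrite negbK].
  rewrite /u; case: asboolP => // nt.
  by case: b Kb {nKb} => // /nt.
pose p w := projT1 (cid (halfspaces_neq0 w (~~ u w))).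
have pP w : halfspace w (~~ u w) (p w) :=
  projT2 (cid (halfspaces_neq0 w (~~ u w))).
(* Walls are grouped by the sides of the members of [F] on which [p w] lies. As [F] is finite there
   are finitely many groups, and each group is flippable at a single 0-cube. *)
pose towards c := [set w | [/\ bad w, ~ F w &
  forall v, F v -> halfspace v (c v) (p w)]].
have fin_towards c : (forall v, ~ F v -> c v = u v) -> finite_set (towards c).
  (* A member [w0] supplies a point [p w0] common to all the sides chosen on [F]. *)
  move=> cu; have [->//|/set0P[w0 [_ _ pw0]]] := eqVneq (towards c) set0.
  have Kside v : ~ F v -> K `<=` halfspace v (c v).
    by move=> Fv y /(uK v Fv)[]; rewrite cu.
  have mixed v v' : F v -> ~ F v' ->
      halfspace v (c v) `&` halfspace v' (c v') !=set0.
    by move=> /(_ (c v))[y [Ky vy]] Fv'; exists y; split=> //; exact: Kside.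
  have c0 : zero_cube c.
    split=> [v v'|y].
      have [Fv|Fv] := pselect (F v); have [Fv'|Fv'] := pselect (F v').
      - by exists (p w0); split; exact: pw0.
      - exact: mixed.
      - by rewrite setIC; exact: mixed.
      - by exists x; split; apply: Kside.
    (* A wall outside [F] whose chosen side misses [y] separates [x] from [y]. *)
    apply: (@sub_finite_set _ _
        (F `|` [set v | separates (@halfspace X W) v x y])).
      move=> v /= vy; have [|Fv] := pselect (F v); [by left|right].
      exists (c v); split; first by rewrite cu //; exact: uK.
      by split; [exact: cover|rewrite negbK].
    by rewrite finite_setU; split=> //; exact: wall_separates_finite.
  apply: sub_finite_set (lf c c0) => w [wbad Fw pw] /=.
  apply/(zero_cube_flip _ _ c0 (halfspaces_neq0 _ _)) => v vw; rewrite (cu w) //.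
  have [Fv|Fv] := pselect (F v).
    by exists (p w); split; [exact: pP|exact: pw].
  (* If the far side of [w] missed the side of [v] towards [K], then [v] would separate [K] from
     [w]. *)
  apply/set0P/eqP => wv; apply: wbad; exists v; split=> //.
  exists (u v), (~~ u w); split; first exact: uK.
  move=> y wy; have vy : ~ halfspace v (c v) y.
    by move=> vy; have : set0 y by rewrite -wv.
  by rewrite -cu //; split; [exact: cover|rewrite negbK].
apply: (@sub_finite_set _ _ (F `|`
  \bigcup_(c in [set c : W -> bool | forall v, ~ F v -> c v = u v]) towards c)).
  move=> w wbad; have [|Fw] := pselect (F w); [by left|right].
  pose c v := if `[< F v >] then `[< halfspace v true (p w) >] else u v.
  exists c => [v Fv|]; first by rewrite /c asboolF.
  split=> // v Fv; rewrite /c asboolT //; case: asboolP => // /cover.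
  exact.
rewrite finite_setU; split=> //; apply: bigcup_finite => //.
exact: finite_bool_fun.
Qed.

(** The constant for [K] is the radius of a ball around a point of [K] that reaches both halfspaces
    of each of the finitely many unseparated walls, so these are all closer to [K] than the
    constant. *)
Lemma separation_of_finite_flips :
    (forall c : orientation W, zero_cube c ->
      finite_set [set w | zero_cube (flip c w)]) ->
  compact_wall_separation W.
Proof.
move=> lf K K0 Kc; have [x Kx] := K0.
have badfin := finite_unseparated _ K0 Kc lf.
set bad := [set w : W | _] in badfin.
pose p b w := projT1 (cid (halfspaces_neq0 w b)).
have pP b w : halfspace w b (p b w) := projT2 (cid (halfspaces_neq0 w b)).
have [|r pr] := compact_sub_ball (p true @` bad `|` p false @` bad) x.
  by apply: finite_compact; rewrite finite_setU; split; exact: finite_image.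
exists r => w; apply: contraPP => wbad; apply/negP; rewrite -ltNge.
have pb b : (set_dist K (halfspace w b) < r%:E)%E.
  apply: le_lt_trans (set_dist_le _ _ _ _ Kx (pP b w)) _.
  have : ball x r (p b w) by apply: pr; case: b; [left|right]; exists w.
  by rewrite ballEmdist lte_fin.
by rewrite /wall_dist gt_max !pb.
Qed.

End Metric.

Theorem theorem5p7 (R : realType) (X : metricType R) (W : wallspace X)
  (nonvacuous : forall w : W, ~ vacuous (@halfspace X W) w)
  (ball_crossed_finite : forall (x : X) (r : R),
    finite_set [set w : W | crosses (@halfspace X W) w (ball x r)]) :
  compact_wall_separation W <-> locally_finite_dual W.
Proof.
have h0 (w : W) b : halfspace w b !=set0 := halfspace_neq0 w b (nonvacuous w).
split=> [cws|/locally_finite_dualE lf].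
  exact/locally_finite_dualE/finite_flips_of_separation.
exact: separation_of_finite_flips.
Qed.
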